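(* Let $\bar x\in\mathbb{R}^n$ be a minimizer of the problem (MPVC). Suppose that at $\bar x$ at least one of the following two constraint qualifications holds: MPVC-GCQ, or GCQ for the auxiliary problem $\mathrm{NLP}(0)$. Then $\bar x$ is $A_0$-stationary. In particular, $\bar x$ is an M-stationary point of (MPVC).
   Context: Let $f:\mathbb{R}^n\to\mathbb{R}$, $g:\mathbb{R}^n\to\mathbb{R}^l$, $h:\mathbb{R}^n\to\mathbb{R}^m$, $G,H:\mathbb{R}^n\to\mathbb{R}^p$ be differentiable functions. The mathematical program with vanishing constraints (MPVC) is: minimize $f(x)$ over $x\in\mathbb{R}^n$ subject to $g(x)\le 0$, $h(x)=0$, and $H_i(x)\ge 0$, $G_i(x)H_i(x)\le 0$ for all $i\in\{1,\dots,p\}$. Index sets: $I^l=\{1,\dots,l\}$, $I^m=\{1,\dots,m\}$, $I^p=\{1,\dots,p\}$, $I^g(x)=\{i\in I^l: g_i(x)=0\}$, and, as subsets of $I^p$, $I^{+0}(x)=\{G_i(x)>0, H_i(x)=0\}$, $I^{0+}(x)=\{G_i(x)=0, H_i(x)>0\}$, $I^{-0}(x)=\{G_i(x)<0, H_i(x)=0\}$, $I^{-+}(x)=\{G_i(x)<0, H_i(x)>0\}$, $I^{00}(x)=\{G_i(x)=0, H_i(x)=0\}$. Weak stationarity: multipliers $\bar\lambda\in\mathbb{R}^l$, $\bar\eta\in\mathbb{R}^m$, $\bar\mu,\bar\nu\in\mathbb{R}^p$ satisfy the system of weak stationarity at a feasible point $\bar x$ of (MPVC) if $$\nabla f(\bar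 x)+\sum_{i\in I^l}\bar\lambda_i\nabla g_i(\bar x)+\sum_{i\in I^m}\bar\eta_i\nabla h_i(\bar x)+\sum_{i\in I^p}\bar\mu_i\nabla G_i(\bar x)-\sum_{i\in I^p}\bar\nu_i\nabla H_i(\bar x)=0,$$ $\bar\lambda_i\ge 0$ for $i\in I^g(\bar x)$, $\bar\lambda_i=0$ for $i\in I^l\setminus I^g(\bar x)$, $\bar\mu_i=0$ for $i\in I^{+0}(\bar x)\cup I^{-0}(\bar x)\cup I^{-+}(\bar x)$, $\bar\mu_i\ge 0$ for $i\in I^{0+}(\bar x)\cup I^{00}(\bar x)$, $\bar\nu_i=0$ for $i\in I^{0+}(\bar x)\cup I^{-+}(\bar x)$, $\bar\nu_i\ge 0$ for $i\in I^{-0}(\bar x)$. A feasible point $\bar x$ of (MPVC) is called M-stationary if there exist multipliers satisfying the system of weak stationarity together with $\bar\mu_i\bar\nu_i=0$ for all $i\in I^{00}(\bar x)$. It is called $A_0$-stationary if there exist multipliers satisfying the system of weak stationarity together with $\bar\mu_i=0$ for all $i\in I^{00}(\bar x)$. The tangent cone to a closed set $F\subset\mathbb{R}^n$ at $\bar x\in F$ is the set of all $d\in\mathbb{R}^n$ for which there are sequences $(x_k)\subset F$, $(t_k)\subset(0,\infty)$ with $x_k\to\bar x$, $t_k\downarrow 0$, $t_k^{-1}(x_k-\bar x)\to d$. The polar cone of $C\subset\mathbb{R}^n$ is $C^\circ=\{d\in\mathbb{R}^n: d^\top y\le 0\ \forall y\in C\}$. MPVC-GCQ: let $\mathcal{T}_{\rm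 MPVC}(\bar x)$ be the tangent cone to the feasible set of (MPVC) at $\bar x$, and let $\mathcal{T}_{\rm MPVC}^{\rm lin}(\bar x)$ be the set of all $d\in\mathbb{R}^n$ with $\nabla g_i(\bar x)^\top d\le 0$ for $i\in I^g(\bar x)$; $\nabla h_i(\bar x)^\top d=0$ for $i\in I^m$; $\nabla G_i(\bar x)^\top d\le 0$ for $i\in I^{0+}(\bar x)$; $\nabla H_i(\bar x)^\top d=0$ for $i\in I^{+0}(\bar x)$; $\nabla H_i(\bar x)^\top d\ge 0$ for $i\in I^{00}(\bar x)\cup I^{-0}(\bar x)$; $(\nabla G_i(\bar x)^\top d)(\nabla H_i(\bar x)^\top d)\le 0$ for $i\in I^{00}(\bar x)$. A feasible point $\bar x$ satisfies MPVC-GCQ if $\mathcal{T}_{\rm MPVC}(\bar x)^\circ=\mathcal{T}_{\rm MPVC}^{\rm lin}(\bar x)^\circ$. GCQ for $\mathrm{NLP}(0)$: given a feasible point $\bar x$ of (MPVC), $\mathrm{NLP}(0)$ is the nonlinear program: minimize $f(x)$ over $x\in\mathbb{R}^n$ subject to $g(x)\le 0$, $h(x)=0$, $H_i(x)=0$ for $i\in I^{+0}(\bar x)\cup I^{00}(\bar x)$, and $G_i(x)\le 0$, $H_i(x)\ge 0$ for $i\in I^{-0}(\bar x)\cup I^{-+}(\bar x)\cup I^{0+}(\bar x)$. GCQ (the Guignard constraint qualification) holds for $\mathrm{NLP}(0)$ at $\bar x$ if the polar cone of the tangent cone at $\bar x$ to the feasible set of $\mathrm{NLP}(0)$ equals the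 polar cone of its standard linearization cone at $\bar x$, i.e. of the set of all $d\in\mathbb{R}^n$ with $\nabla g_i(\bar x)^\top d\le 0$ for $i\in I^g(\bar x)$; $\nabla h_i(\bar x)^\top d=0$ for $i\in I^m$; $\nabla H_i(\bar x)^\top d=0$ for $i\in I^{+0}(\bar x)\cup I^{00}(\bar x)$; $\nabla G_i(\bar x)^\top d\le 0$ for $i\in I^{0+}(\bar x)$; $\nabla H_i(\bar x)^\top d\ge 0$ for $i\in I^{-0}(\bar x)$. *)

(* Defs.v *)
From mathcomp Require Import all_boot all_order all_algebra.
From mathcomp Require Import all_classical all_reals all_analysis.

Set Implicit Arguments.
Unset Strict Implicit.
Unset Printing Implicit Defensive.

Import Order.TTheory GRing.Theory Num.Theory.
Import numFieldNormedType.Exports.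

Local Open Scope classical_set_scope.
Local Open Scope ring_scope.

Definition dotv (R : realType) (n : nat) (u v : 'rV[R]_n) : R :=
  \sum_(j < n) u 0 j * v 0 j.

(* Vector of partial derivatives; 'D is total, so this is the gradient only
   where [f] is differentiable. *)
Definition gradient (R : realType) (n : nat) (f : 'rV[R]_n -> R)
    (x : 'rV[R]_n) : 'rV[R]_n :=
  \row_(j < n) 'D_(delta_mx 0 j) f x.

Definition tangent_cone (R : realType) (n : nat) (F : set 'rV[R]_n)
    (x : 'rV[R]_n) : set 'rV[R]_n :=
  [set d | exists (y : nat -> 'rV[R]_n) (t : nat -> R),
    [/\ forall k, F (y k),
        forall k, 0 < t k,
        y @ \oo --> x,
        t @ \oo --> (0 : R) &
        (fun k => (t k)^-1 *: (y k - x)) @ \oo --> d]].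

Definition polar_cone (R : realType) (n : nat) (C : set 'rV[R]_n) :
    set 'rV[R]_n :=
  [set d | forall y, C y -> dotv d y <= 0].

Record mpvc (R : realType) (n l m p : nat) := MPVC {
  obj : 'rV[R]_n -> R;
  cg : 'rV[R]_n -> 'rV[R]_l;
  ch : 'rV[R]_n -> 'rV[R]_m;
  cG : 'rV[R]_n -> 'rV[R]_p;
  cH : 'rV[R]_n -> 'rV[R]_p }.

Definition mpvc_differentiable (R : realType) (n l m p : nat)
    (P : mpvc R n l m p) : Prop :=
  forall x, [/\ differentiable (obj P) x, differentiable (cg P) x,
    differentiable (ch P) x, differentiable (cG P) x &
    differentiable (cH P) x].

Definition mpvc_feasible (R : realType) (n l m p : nat) (P : mpvc R n l m p) :
    set 'rV[R]_n :=
  [set x | [/\ forall i, cg P x 0 i <= 0,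
               forall i, ch P x 0 i = 0,
               forall i, 0 <= cH P x 0 i &
               forall i, cG P x 0 i * cH P x 0 i <= 0]].

Definition mpvc_minimizer (R : realType) (n l m p : nat) (P : mpvc R n l m p)
    (x : 'rV[R]_n) : Prop :=
  mpvc_feasible P x /\ forall y, mpvc_feasible P y -> obj P x <= obj P y.

Definition grad_g (R : realType) (n l m p : nat) (P : mpvc R n l m p)
    (i : 'I_l) : 'rV[R]_n -> 'rV[R]_n := gradient (fun y => cg P y 0 i).
Definition grad_h (R : realType) (n l m p : nat) (P : mpvc R n l m p)
    (i : 'I_m) : 'rV[R]_n -> 'rV[R]_n := gradient (fun y => ch P y 0 i).
Definition grad_G (R : realType) (n l m p : nat) (P : mpvc R n l m p)
    (i : 'I_p) : 'rV[R]_n -> 'rV[R]_n := gradient (fun y => cG P y 0 i).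
Definition grad_H (R : realType) (n l m p : nat) (P : mpvc R n l m p)
    (i : 'I_p) : 'rV[R]_n -> 'rV[R]_n := gradient (fun y => cH P y 0 i).

(* In the names [I_ab], [a] is the sign of G_i(x) and [b] the sign of H_i(x),
   with p, m and 0 for positive, negative and zero. *)
Definition I_g (R : realType) (n l m p : nat) (P : mpvc R n l m p)
    (x : 'rV[R]_n) : set 'I_l := [set i | cg P x 0 i = 0].
Definition I_p0 (R : realType) (n l m p : nat) (P : mpvc R n l m p)
    (x : 'rV[R]_n) : set 'I_p := [set i | 0 < cG P x 0 i /\ cH P x 0 i = 0].
Definition I_0p (R : realType) (n l m p : nat) (P : mpvc R n l m p)
    (x : 'rV[R]_n) : set 'I_p := [set i | cG P x 0 i = 0 /\ 0 < cH P x 0 i].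
Definition I_m0 (R : realType) (n l m p : nat) (P : mpvc R n l m p)
    (x : 'rV[R]_n) : set 'I_p := [set i | cG P x 0 i < 0 /\ cH P x 0 i = 0].
Definition I_mp (R : realType) (n l m p : nat) (P : mpvc R n l m p)
    (x : 'rV[R]_n) : set 'I_p := [set i | cG P x 0 i < 0 /\ 0 < cH P x 0 i].
Definition I_00 (R : realType) (n l m p : nat) (P : mpvc R n l m p)
    (x : 'rV[R]_n) : set 'I_p := [set i | cG P x 0 i = 0 /\ cH P x 0 i = 0].

Record weak_stationarity (R : realType) (n l m p : nat) (P : mpvc R n l m p)
    (x : 'rV[R]_n) (lambda : 'rV[R]_l) (eta : 'rV[R]_m) (mu nu : 'rV[R]_p) :
    Prop := WeakStationarity {
  ws_lagrange :
    gradient (obj P) x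
    + \sum_(i < l) lambda 0 i *: grad_g P i x
    + \sum_(i < m) eta 0 i *: grad_h P i x
    + \sum_(i < p) mu 0 i *: grad_G P i x
    - \sum_(i < p) nu 0 i *: grad_H P i x = 0;
  ws_lambda_ge0 : forall i, I_g P x i -> 0 <= lambda 0 i;
  ws_lambda_eq0 : forall i, (~` I_g P x) i -> lambda 0 i = 0;
  ws_mu_eq0 : forall i, (I_p0 P x `|` I_m0 P x `|` I_mp P x) i -> mu 0 i = 0;
  ws_mu_ge0 : forall i, (I_0p P x `|` I_00 P x) i -> 0 <= mu 0 i;
  ws_nu_eq0 : forall i, (I_0p P x `|` I_mp P x) i -> nu 0 i = 0;
  ws_nu_ge0 : forall i, I_m0 P x i -> 0 <= nu 0 i }.

Definition M_stationary (R : realType) (n l m p : nat) (P : mpvc R n l m p)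
    (x : 'rV[R]_n) : Prop :=
  mpvc_feasible P x /\
  exists (lambda : 'rV[R]_l) (eta : 'rV[R]_m) (mu nu : 'rV[R]_p),
    weak_stationarity P x lambda eta mu nu /\
    (forall i, I_00 P x i -> mu 0 i * nu 0 i = 0).

Definition A0_stationary (R : realType) (n l m p : nat) (P : mpvc R n l m p)
    (x : 'rV[R]_n) : Prop :=
  mpvc_feasible P x /\
  exists (lambda : 'rV[R]_l) (eta : 'rV[R]_m) (mu nu : 'rV[R]_p),
    weak_stationarity P x lambda eta mu nu /\
    (forall i, I_00 P x i -> mu 0 i = 0).

Record mpvc_lin (R : realType) (n l m p : nat) (P : mpvc R n l m p)
    (x d : 'rV[R]_n) : Prop := MpvcLin {
  ml_g : forall i, I_g P x i -> dotv (grad_g P i x) d <= 0;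
  ml_h : forall i, dotv (grad_h P i x) d = 0;
  ml_G : forall i, I_0p P x i -> dotv (grad_G P i x) d <= 0;
  ml_H_eq0 : forall i, I_p0 P x i -> dotv (grad_H P i x) d = 0;
  ml_H_ge0 : forall i, (I_00 P x `|` I_m0 P x) i -> 0 <= dotv (grad_H P i x) d;
  ml_GH : forall i, I_00 P x i ->
    dotv (grad_G P i x) d * dotv (grad_H P i x) d <= 0 }.

Definition mpvc_lin_cone (R : realType) (n l m p : nat) (P : mpvc R n l m p)
    (x : 'rV[R]_n) : set 'rV[R]_n := [set d | mpvc_lin P x d].

Definition mpvc_GCQ (R : realType) (n l m p : nat) (P : mpvc R n l m p)
    (x : 'rV[R]_n) : Prop :=
  polar_cone (tangent_cone (mpvc_feasible P) x) =
  polar_cone (mpvc_lin_cone P x).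

(* The reference point [xb] selects the constraints; [x] is the variable. *)
Definition nlp0_feasible (R : realType) (n l m p : nat) (P : mpvc R n l m p)
    (xb : 'rV[R]_n) : set 'rV[R]_n :=
  [set x | [/\ forall i, cg P x 0 i <= 0,
               forall i, ch P x 0 i = 0,
               forall i, (I_p0 P xb `|` I_00 P xb) i -> cH P x 0 i = 0 &
               forall i, (I_m0 P xb `|` I_mp P xb `|` I_0p P xb) i ->
                 cG P x 0 i <= 0 /\ 0 <= cH P x 0 i]].

Record nlp0_lin (R : realType) (n l m p : nat) (P : mpvc R n l m p)
    (x d : 'rV[R]_n) : Prop := Nlp0Lin {
  nl_g : forall i, I_g P x i -> dotv (grad_g P i x) d <= 0;
  nl_h : forall i, dotv (grad_h P i x) d = 0;
  nl_H_eq0 : forall i, (I_p0 P x `|` I_00 P x) i -> dotv (grad_H P i x) d = 0;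
  nl_G : forall i, I_0p P x i -> dotv (grad_G P i x) d <= 0;
  nl_H_ge0 : forall i, I_m0 P x i -> 0 <= dotv (grad_H P i x) d }.

Definition nlp0_lin_cone (R : realType) (n l m p : nat) (P : mpvc R n l m p)
    (x : 'rV[R]_n) : set 'rV[R]_n := [set d | nlp0_lin P x d].

Definition nlp0_GCQ (R : realType) (n l m p : nat) (P : mpvc R n l m p)
    (x : 'rV[R]_n) : Prop :=
  polar_cone (tangent_cone (nlp0_feasible P x) x) =
  polar_cone (nlp0_lin_cone P x).

(* Main.v *)
(** First-order optimality puts -grad f in the polar of the tangent cone of the
    feasible set, hence, under either constraint qualification, in the polar of
    the linearization cone of NLP(0): the feasible set of NLP(0) is contained
    in that of (MPVC), and its linearization cone in that of (MPVC).
    As the linearization cone of NLP(0) is polyhedral, Farkas' lemma yields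
    multipliers; it does not involve G_i for i in I^{00}, whence mu_i = 0. *)
Require Import Defs.
From mathcomp Require Import all_boot all_order all_algebra.
From mathcomp Require Import all_classical all_reals all_analysis.

Set Implicit Arguments.
Unset Strict Implicit.
Unset Printing Implicit Defensive.

Import Order.TTheory GRing.Theory Num.Theory.
Import numFieldNormedType.Exports.
Local Open Scope classical_set_scope.
Local Open Scope ring_scope.

Lemma dotvC (R : realType) (n : nat) (u v : 'rV[R]_n) : dotv u v = dotv v u.
Proof. by apply: eq_bigr => j _; rewrite mulrC. Qed.

Lemma dotvDl (R : realType) (n : nat) (u v w : 'rV[R]_n) :
  dotv (u + v) w = dotv u w + dotv v w.
Proof. by rewrite -big_split; apply: eq_bigr => j _; rewrite mxE mulrDl. Qed.

Lemma dotvZl (R : realType) (n : nat) c (u w : 'rV[R]_n) :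
  dotv (c *: u) w = c * dotv u w.
Proof.
by rewrite /dotv mulr_sumr; apply: eq_bigr => j _; rewrite mxE mulrA.
Qed.

Lemma dotvNl (R : realType) (n : nat) (u w : 'rV[R]_n) :
  dotv (- u) w = - dotv u w.
Proof. by rewrite -scaleN1r dotvZl mulN1r. Qed.

Lemma dotvDr (R : realType) (n : nat) (u v w : 'rV[R]_n) :
  dotv u (v + w) = dotv u v + dotv u w.
Proof. by rewrite dotvC dotvDl !(dotvC u). Qed.

Lemma dotvZr (R : realType) (n : nat) c (u w : 'rV[R]_n) :
  dotv u (c *: w) = c * dotv u w.
Proof. by rewrite dotvC dotvZl dotvC. Qed.

Lemma dotvNr (R : realType) (n : nat) (u w : 'rV[R]_n) :
  dotv u (- w) = - dotv u w.
Proof. by rewrite dotvC dotvNl dotvC. Qed.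

Lemma dotvv_le0 (R : realType) (n : nat) (u : 'rV[R]_n) :
  dotv u u <= 0 -> u = 0.
Proof.
move=> u_le0; apply/rowP => j; rewrite mxE; apply/eqP; rewrite -sqrf_eq0.
have sq_ge0 i : true -> 0 <= u 0 i * u 0 i by rewrite -expr2 sqr_ge0.
have /eqP : dotv u u = 0 by apply/le_anti; rewrite u_le0 sumr_ge0.
by rewrite psumr_eq0// => /allP/(_ j (mem_index_enum _)); rewrite expr2.
Qed.

(** [E] marks the equality constraints; these are the ones whose multipliers carry no sign in
    Farkas' lemma. *)
Definition cone_constraint (R : realType) (I : eqType) (n : nat) (E : pred I)
    (a : I -> 'rV[R]_n) (d : 'rV[R]_n) (i : I) : Prop :=
  if E i then dotv (a i) d = 0 else dotv (a i) d <= 0.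

(* Induction on the number of constraints: if [a i0] cannot be dropped, this is
   witnessed by some [y] with [dotv (a i0) y != 0], and the other constraints
   are replaced by their compositions with the projection along [y] onto the
   hyperplane orthogonal to [a i0]. *)
Lemma farkas (R : realType) (I : eqType) (n : nat) (E : pred I) (r : seq I)
    (a : I -> 'rV[R]_n) (b : 'rV[R]_n) :
  uniq r ->
  (forall d, {in r, forall i, cone_constraint E a d i} -> dotv b d <= 0) ->
  exists2 c : I -> R, (forall i, ~~ E i -> 0 <= c i) &
    b = \sum_(i <- r) c i *: a i.
Proof.
elim: r a b => [|i0 r IHr] a b.
  (* Without constraints [b] is itself an admissible [d], which forces [b = 0]. *)
  move=> _ b_le0; exists (fun=> 0) => //; rewrite big_nil.
  exact/dotvv_le0/b_le0.
move=> /= /andP[i0r r_uniq] b_le0.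
have updE c c0 : \sum_(i <- i0 :: r) (if i == i0 then c0 else c i) *: a i =
    c0 *: a i0 + \sum_(i <- r) c i *: a i.
  rewrite big_cons eqxx; congr (_ + _); apply: eq_big_seq => i ir.
  by case: eqP => // ii0; rewrite -ii0 ir in i0r.
have [b_cons|] := pselect (forall d,
    {in r, forall i, cone_constraint E a d i} -> dotv b d <= 0).
  have [c c_ge0 ->] := IHr a b r_uniq b_cons.
  exists (fun i => if i == i0 then 0 else c i).
    by move=> i /c_ge0; case: ifP.
  by rewrite updE scale0r add0r.
move=> /existsNP[y /not_implyP[yr /negP]]; rewrite -ltNge => by_gt0.
(* The vector [y] meets the constraints in [r] but [dotv b y > 0], so it must violate the one of
   [i0]. *)
have not_y0 : ~ cone_constraint E a y i0.
  move=> y0; have : dotv b y <= 0.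
    by apply: b_le0 => i; rewrite in_cons => /predU1P[->//|/yr].
  by rewrite leNgt by_gt0.
set q := dotv (a i0) y in not_y0 *.
have q_neq0 : q != 0.
  apply/eqP => q0; apply: not_y0; rewrite /cone_constraint -/q q0.
  by case: ifP.
have q_gt0 : ~~ E i0 -> 0 < q.
  move=> /negbTE Ei0; rewrite ltNge; apply/negP => q_le0.
  by apply: not_y0; rewrite /cone_constraint Ei0.
(* [pr] is the transpose of the projection along [y]; a projected vector meets the constraint of
   [i0] with equality. *)
pose pr (v : 'rV[R]_n) := v - (dotv v y / q) *: a i0.
have prE v d : dotv (pr v) d = dotv v (d - (dotv (a i0) d / q) *: y).
  rewrite /pr dotvDl dotvNl dotvZl dotvDr dotvNr dotvZr; congr (_ - _).
  by rewrite mulrAC [RHS]mulrC mulrA.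
have [|c c_ge0 pbE] := IHr (pr \o a) (pr b) r_uniq.
  move=> d dr; rewrite prE; apply: b_le0 => i; rewrite in_cons.
  case/predU1P => [->|/dr]; last by rewrite /cone_constraint /= !prE.
  rewrite /cone_constraint dotvDr dotvNr dotvZr -/q divfK// subrr.
  by case: ifP.
(* Expanding [pr] in the decomposition of [pr b] gives the coefficient of [a i0]. Its numerator is
   positive, as [dotv b y > 0] while each [c j * dotv (a j) y <= 0] by the choice of [y]. *)
exists (fun i => if i == i0
    then (dotv b y - \sum_(j <- r) c j * dotv (a j) y) / q else c i).
  move=> i; case: eqP => [->|_ /c_ge0//] Ei0.
  rewrite divr_ge0 ?ltW ?q_gt0// subr_gt0; apply: le_lt_trans by_gt0.
  rewrite big_seq sumr_le0// => j jr.
  have := yr j jr; rewrite /cone_constraint; case: ifPn => [_ ->|Ej ajy].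
    by rewrite mulr0.
  by rewrite mulr_ge0_le0 ?c_ge0.
rewrite updE -[LHS](subrK ((dotv b y / q) *: a i0)) -/(pr b) pbE.
rewrite mulrBl scalerBl [LHS]addrC -addrA; congr (_ + _).
rewrite mulr_suml scaler_suml -sumrN -big_split; apply: eq_bigr => j _ /=.
by rewrite scalerBr scalerA mulrA addrC.
Qed.

(** Only the constraints in [A] are enumerated, and the multipliers are extended by zero; this
    yields complementarity for the inactive constraints. *)
Lemma farkas_fin (R : realType) (I : finType) (n : nat) (A E : pred I)
    (a : I -> 'rV[R]_n) (b : 'rV[R]_n) :
  (forall d, (forall i, A i -> cone_constraint E a d i) -> dotv b d <= 0) ->
  exists c : I -> R, [/\ forall i, ~~ A i -> c i = 0,
    forall i, ~~ E i -> 0 <= c i & b = \sum_i c i *: a i].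
Proof.
move=> b_le0.
have [|c c_ge0 ->] := @farkas R I n E (enum A) a b (enum_uniq A).
  by move=> d dA; apply: b_le0 => i Ai; apply: dA; rewrite mem_enum.
exists (fun i => if A i then c i else 0); split.
- by move=> i /negbTE ->.
- by move=> i /c_ge0; case: ifP.
- rewrite big_enum big_mkcond; apply: eq_bigr => i _.
  by rewrite unfold_in; case: ifP; rewrite ?scale0r.
Qed.

Lemma diff_gradient (R : realType) (n : nat) (f : 'rV[R]_n -> R)
    (x v : 'rV[R]_n) :
  differentiable f x -> 'd f x v = dotv (gradient f x) v.
Proof.
move=> df; rewrite [in LHS](row_sum_delta v) linear_sum.
by apply: eq_bigr => j _; rewrite linearZ mxE deriveE// mulrC.
Qed.

(** Along a sequence defining [d], the difference quotients of [f] are nonnegative and tend to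
    ['d f x d]. *)
Lemma minimizer_polar_tangent (R : realType) (n : nat) (f : 'rV[R]_n -> R)
    (F : set 'rV[R]_n) (x : 'rV[R]_n) :
  differentiable f x -> (forall y, F y -> f x <= f y) ->
  polar_cone (tangent_cone F x) (- gradient f x).
Proof.
move=> df x_min d [y [t [Fy t_gt0 yx _ yd]]].
rewrite dotvNl oppr_le0 -diff_gradient//.
apply/ler_addgt0Pr => e e_gt0.
(* With tolerance [e / (1 + |d|)] the remainder, once divided by [t k], has a limiting bound of at
   most [e]; the summand 1 covers [d = 0]. *)
have D_gt0 : 0 < 1 + `|d| by rewrite ltr_pwDl.
have e'_gt0 : 0 < e / (1 + `|d|) by rewrite divr_gt0.
set w := (fun k => _) in yd.
have dw : 'd f x (w k) @[k --> \oo] --> 'd f x d.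
  by apply: cvg_comp yd _; exact: diff_continuous.
have limE : 'd f x (w k) + e / (1 + `|d|) * `|w k| @[k --> \oo]
    --> 'd f x d + e / (1 + `|d|) * `|d|.
  by apply: cvgD => //; apply: cvgMl_tmp; exact: cvg_norm.
have yx0 : y k - x @[k --> \oo] --> (0 : 'rV[R]_n).
  by rewrite -(subrr x); apply: cvgB => //; exact: cvg_cst.
have : 0 <= 'd f x d + e / (1 + `|d|) * `|d|.
  apply: (cvgr_to_ge limE).
  have /eqaddoP/(_ _ e'_gt0) rP := diff_locally df.
  have : \forall k \near \oo, `|f (y k) - (f x + 'd f x (y k - x))|
      <= e / (1 + `|d|) * `|y k - x|.
    have := yx0 _ rP; rewrite /nbhs/=; apply: filterS => k /=.
    by rewrite !fctE /= subrK.
  (* Multiplying by [t k] turns the claim into a bound on the expansion of [f (y k) - f x], which is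
     nonnegative by minimality. *)
  apply: filterS => k rk; rewrite -(pmulr_rge0 _ (t_gt0 k)) mulrDr.
  have -> : t k * 'd f x (w k) = 'd f x (y k - x).
    by rewrite /w linearZ /= mulrA divff ?mul1r// gt_eqF.
  rewrite mulrCA /w normrZ gtr0_norm ?invr_gt0// mulVKf ?gt_eqF//.
  have := x_min _ (Fy k); rewrite -subr_ge0 => /le_trans; apply.
  by rewrite -lerBlDl -addrA -opprD (le_trans (ler_norm _)).
move=> /le_trans; apply; rewrite lerD2l -mulrAC ler_pdivrMr// ler_wpM2l ?ltW//.
by rewrite ltr_pwDl.
Qed.

(** Feasibility of [xb] places each index in one of the five sign classes. Either H_i is forced to
    vanish at [y], and the product with it, or G_i and H_i have opposite weak signs there. *)
Lemma nlp0_feasible_sub (R : realType) (n l m p : nat) (P : mpvc R n l m p)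
    (xb : 'rV[R]_n) :
  mpvc_feasible P xb -> nlp0_feasible P xb `<=` mpvc_feasible P.
Proof.
move=> [_ _ Hxb GHxb] y [gy hy H0 GH0].
suff GH i : 0 <= cH P y 0 i /\ cG P y 0 i * cH P y 0 i <= 0.
  by split=> // i; have [] := GH i.
have [Hi|Hi|/esym Hi] := ltgtP 0 (cH P xb 0 i); last first.
- have [Gi|Gi|Gi] := ltgtP (cG P xb 0 i) 0.
  + have [|Gy Hy] := GH0 i; first by left; left.
    by split=> //; exact: mulr_le0_ge0.
  + by rewrite H0 ?mulr0//; left.
  + by rewrite H0 ?mulr0//; right.
- by have := Hxb i; rewrite leNgt Hi.
- have Gi : cG P xb 0 i <= 0 by rewrite -(pmulr_lle0 _ Hi).
  have [|Gy Hy] := GH0 i; last by split=> //; exact: mulr_le0_ge0.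
  move: Gi; rewrite le_eqVlt => /predU1P[Gi|Gi]; first by right.
  by left; right.
Qed.

(** On I^{00} the linear equation for H_i makes the product in the nonconvex condition of (MPVC)
    vanish. *)
Lemma nlp0_lin_sub (R : realType) (n l m p : nat) (P : mpvc R n l m p)
    (x : 'rV[R]_n) : nlp0_lin_cone P x `<=` mpvc_lin_cone P x.
Proof.
move=> d [dg dh dH0 dG dH]; split=> //.
- by move=> i Ii; apply: dH0; left.
- by move=> i [Ii|/dH//]; rewrite dH0//; right.
- by move=> i Ii; rewrite dH0 ?mulr0//; right.
Qed.

Lemma polar_coneS (R : realType) (n : nat) (C D : set 'rV[R]_n) :
  C `<=` D -> polar_cone D `<=` polar_cone C.
Proof. by move=> CD d dD y /CD; exact: dD. Qed.

Lemma polar_nlp0_lin_multipliers (R : realType) (n l m p : nat)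
    (P : mpvc R n l m p) (x : 'rV[R]_n) :
  polar_cone (nlp0_lin_cone P x) (- gradient (obj P) x) ->
  exists (lambda : 'rV[R]_l) (eta : 'rV[R]_m) (mu nu : 'rV[R]_p),
    weak_stationarity P x lambda eta mu nu /\
    (forall i, I_00 P x i -> mu 0 i = 0).
Proof.
move=> polar.
(* The four summands index g, h, G and H; [A] selects the constraints of the linearization cone and
   [E] the equalities among them. *)
pose I := ('I_l + 'I_m + 'I_p + 'I_p)%type.
pose A (i : I) := match i with
  | inl (inl (inl i)) => `[< I_g P x i >]
  | inl (inl (inr i)) => true
  | inl (inr i) => `[< I_0p P x i >]
  | inr i => `[< (I_p0 P x `|` I_00 P x `|` I_m0 P x) i >]
  end.
pose E (i : I) := match i with
  | inl (inl (inl i)) => false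
  | inl (inl (inr i)) => true
  | inl (inr i) => false
  | inr i => `[< (I_p0 P x `|` I_00 P x) i >]
  end.
(* The sign of the H-gradients is flipped to turn [>=] into [<=], which also produces the minus sign
   before [nu]. *)
pose a (i : I) := match i with
  | inl (inl (inl i)) => grad_g P i x
  | inl (inl (inr i)) => grad_h P i x
  | inl (inr i) => grad_G P i x
  | inr i => - grad_H P i x
  end.
have [d dA|c [c0 c_ge0]] := @farkas_fin R I n A E a (- gradient (obj P) x).
  apply: polar; split.
  - by move=> i Ii; apply: (dA (inl (inl (inl i)))); exact/asboolP.
  - by move=> i; exact: (dA (inl (inl (inr i)))).
  - move=> i Ii; apply/eqP; rewrite -oppr_eq0 -dotvNl; apply/eqP.
    have : A (inr i) by apply/asboolP; left.
    by move/dA; rewrite /cone_constraint /= asboolT.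
  - by move=> i Ii; apply: (dA (inl (inr i))); exact/asboolP.
  - move=> i Ii; rewrite -oppr_le0 -dotvNl.
    have : A (inr i) by apply/asboolP; right.
    by move/dA; rewrite /cone_constraint /=; case: ifP => // _ ->.
rewrite !big_sumType /= => gradE.
exists (\row_i c (inl (inl (inl i)))), (\row_i c (inl (inl (inr i)))),
  (\row_i c (inl (inr i))), (\row_i c (inr i)).
(* Sign conditions hold for indices outside [E], vanishing ones outside [A]; disjointness of the
   index sets settles membership. *)
split; first split.
- under eq_bigr do rewrite mxE.
  under [X in _ + X + _ - _]eq_bigr do rewrite mxE.
  under [X in _ + X - _]eq_bigr do rewrite mxE.
  under [X in _ - X]eq_bigr do rewrite mxE.
  rewrite -sumrN; under [X in _ + X]eq_bigr do rewrite -scalerN.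
  by rewrite -!addrA; apply/eqP; rewrite addr_eq0 -eqr_oppLR gradE !addrA.
- by move=> i _; rewrite mxE c_ge0.
- by move=> i Ii; rewrite mxE c0//; apply/asboolPn.
- move=> i Ii; rewrite mxE c0//=; apply/asboolPn => -[G0 Hi].
  by case: Ii => [[]|] [] /lt_eqF; rewrite G0 ?eqxx// .
- by move=> i _; rewrite mxE c_ge0.
- move=> i Ii; rewrite mxE c0//=; apply/asboolPn => -[[]|] [_ H0];
    by case: Ii => -[_]; rewrite H0 ltxx.
- move=> i [Gi Hi]; rewrite mxE c_ge0//=; apply/asboolPn => -[[+ _]|[+ _]].
  + by move=> /(lt_trans Gi); rewrite ltxx.
  + by move=> Gi0; rewrite Gi0 ltxx in Gi.
- move=> i [Gi Hi]; rewrite mxE c0//=; apply/asboolPn => -[_].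
  by rewrite Hi ltxx.
Qed.

Theorem theorem5p1 (R : realType) (n l m p : nat)
    (f : 'rV[R]_n -> R) (g : 'rV[R]_n -> 'rV[R]_l) (h : 'rV[R]_n -> 'rV[R]_m)
    (G H : 'rV[R]_n -> 'rV[R]_p) (xbar : 'rV[R]_n) :
  let P := MPVC f g h G H in
  mpvc_differentiable P ->
  mpvc_minimizer P xbar ->
  mpvc_GCQ P xbar \/ nlp0_GCQ P xbar ->
  A0_stationary P xbar /\ M_stationary P xbar.
Proof.
move=> P /(_ xbar)[df _ _ _ _] [xF x_min] GCQ.
have : polar_cone (nlp0_lin_cone P xbar) (- gradient f xbar).
  case: GCQ => [GCQ|<-].
    apply: (polar_coneS (@nlp0_lin_sub _ _ _ _ _ P xbar)); rewrite -GCQ.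
    exact: minimizer_polar_tangent.
  (* The value [f xbar] is also a lower bound on the smaller feasible set of NLP(0). *)
  apply: minimizer_polar_tangent => // y /(nlp0_feasible_sub xF); exact: x_min.
move=> /(@polar_nlp0_lin_multipliers _ _ _ _ _ P).
move=> [lambda [eta [mu [nu [ws mu0]]]]].
split; split=> //; exists lambda, eta, mu, nu; split=> // i Ii.
by rewrite mu0 ?mul0r.
Qed.
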